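(* Let $F$ be the free group of rank $2$. Then the graph $\Gamma^*(F)$ is connected.
   Context: For a group $G$, the generating graph $\Gamma(G)$ is the simple undirected graph whose vertices are the elements of $G$, two distinct vertices $g_1,g_2$ being adjacent if and only if $\langle g_1,g_2\rangle=G$. $\Gamma^*(G)$ is the subgraph of $\Gamma(G)$ induced by all vertices of $\Gamma(G)$ that are not isolated. *)

(* Defs.v *)
From mathcomp Require Import all_boot.
From mathcomp Require Import boolp classical_sets.
From Stdlib Require Import Relation_Operators.

Set Implicit Arguments.
Unset Strict Implicit.
Unset Printing Implicit Defensive.

Local Open Scope classical_set_scope.
Local Open Scope group_scope.

(* A simple undirected graph whose vertex set is a subset of the type [T]. *)
Record simple_graph (T : Type) := SimpleGraph {
  vertices : set T;
  adj : T -> T -> Prop;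
  adj_vertices : forall x y, adj x y -> vertices x /\ vertices y;
  adj_sym : forall x y, adj x y -> adj y x;
  adj_irrefl : forall x, ~ adj x x
}.

Section GraphTheory.
Variables (T : Type) (g : simple_graph T).

Definition isolated : set T :=
  [set x | vertices g x /\ forall y, ~ adj g x y].

Section Induced.
Variable W : set T.

Definition induced_adj (x y : T) : Prop := [/\ W x, W y & adj g x y].

Lemma induced_adj_vertices x y : induced_adj x y ->
  (vertices g `&` W) x /\ (vertices g `&` W) y.
Proof. by move=> [Wx Wy xy]; have [vx vy] := adj_vertices xy. Qed.

Lemma induced_adj_sym x y : induced_adj x y -> induced_adj y x.
Proof. by move=> [Wx Wy xy]; split=> //; exact: adj_sym. Qed.

Lemma induced_adj_irrefl x : ~ induced_adj x x.
Proof. by move=> [_ _ xx]; exact: (adj_irrefl xx). Qed.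

Definition induced_subgraph : simple_graph T :=
  SimpleGraph induced_adj_vertices induced_adj_sym induced_adj_irrefl.
End Induced.

(* The empty graph does not count as connected.  Since adjacent elements are
   vertices, a walk between two vertices stays inside the graph. *)
Definition connected_graph : Prop :=
  vertices g !=set0 /\
  forall x y, vertices g x -> vertices g y -> clos_refl_trans T (adj g) x y.
End GraphTheory.

Section GeneratingGraph.
Variable G : groupType.

Definition is_subgroup (H : set G) : Prop := group_closed (mem H).

Definition generated (A : set G) : set G := smallest is_subgroup A.

Definition gen_adj (x y : G) : Prop :=
  x <> y /\ generated [set x; y] = [set: G].

Lemma gen_adj_vertices x y : gen_adj x y -> [set: G] x /\ [set: G] y.
Proof. by []. Qed.

Lemma gen_adj_sym x y : gen_adj x y -> gen_adj y x.
Proof. by case=> xy gxy; split; [exact/nesym | rewrite setUC]. Qed.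

Lemma gen_adj_irrefl x : ~ gen_adj x x.
Proof. by case. Qed.

Definition generating_graph : simple_graph G :=
  SimpleGraph gen_adj_vertices gen_adj_sym gen_adj_irrefl.

Definition generating_graph_star : simple_graph G :=
  induced_subgraph generating_graph (~` isolated generating_graph).
End GeneratingGraph.

(* Universal property of the free group on [b 0, ..., b (n - 1)].  A
   multiplicative map between groups is a group morphism.  The carrier of a
   [groupType] is a [choiceType]; classically this excludes no group. *)
Definition free_basis (F : groupType) (n : nat) (b : 'I_n -> F) : Prop :=
  forall (H : groupType) (h : 'I_n -> H),
    exists f : {multiplicative F -> H},
      (forall i, f (b i) = h i) /\
      (forall f' : {multiplicative F -> H},
         (forall i, f' (b i) = h i) -> f' =1 f).

Definition is_free_group (F : groupType) (n : nat) : Prop :=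
  exists b : 'I_n -> F, free_basis b.

(* Main.v *)
Require Import Defs.
From HB Require Import structures.
From mathcomp Require Import all_boot.
From mathcomp Require Import boolp classical_sets zify.
From Stdlib Require Import Relation_Operators.

(** A Nielsen move on a generating pair changes one entry and keeps the other,
    which is adjacent to both the old and the new value; so Nielsen moves never
    leave a connected component of the graph.  Neither does conjugation: if [x]
    and [y] generate [F], then [y] is adjacent to [x] and to [x ^ y], and since
    they generate [F], [x] is linked to all its conjugates ([linked_conj]).

    The length of normal forms, with the length of common prefixes, makes [F]
    act on a tree; Lyndon's axioms ([lyndon_length]) record what is needed of
    it.  In the component of a given vertex, choose a generating pair [u], [v]
    of minimal total length.  Minimality under Nielsen moves says that at most
    half of a factor cancels in a product of two letters among [u], [v] and
    their inverses.  The remaining degenerate case is that of a letter [u] of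
    which exactly one half cancels against each neighbour in [v * u * v].
    Then [u] is [p * q^-1] with [p] and [q] of equal length and [v] is
    [q * m * p^-1], and conjugating [u] and [v * u] by [q] gives [q^-1 * p] and
    [m], which is a shorter pair ([minimal_pair_core]).  Allowing conjugations
    thus replaces the usual tie-breaking well-order of Nielsen's method.

    A minimal pair is therefore Nielsen reduced: each letter of a freely reduced
    product keeps a nonempty part, so a product of two or more letters has
    length at least 2 ([freely_reduced_len]).  An element of length 1, such as a
    basis element, must itself be one of [u], [v] and their inverses, so every
    component contains it ([spans_linked_len1]). *)

Set Implicit Arguments.
Unset Strict Implicit.
Unset Printing Implicit Defensive.

Local Open Scope group_scope.

(** * Generating pairs and paths in the graph *)

Section Spanning.
Variable G : groupType.
Implicit Types (A : set G) (g h u v x y : G).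

Lemma generated_sub A (P : G -> Prop) :
    P 1 -> (forall g h, P g -> P h -> P (g * h^-1)) ->
  (forall g, A g -> P g) -> forall g, generated A g -> P g.
Proof.
move=> P1 PD PA g; apply; split=> //.
split; first exact/mem_set.
by move=> u v /set_mem Pu /set_mem Pv; apply/mem_set/PD.
Qed.

Lemma generated_mem A g : A g -> generated A g.
Proof. by move=> Ag H [_]; apply. Qed.

Lemma generated1 A : generated A 1.
Proof. by move=> H [[/set_mem]]. Qed.

Lemma generatedD A g h : generated A g -> generated A h -> generated A (g * h^-1).
Proof.
move=> Ag Ah H HA; have [[_ HD] _] := HA.
by apply/set_mem/(HD g h); apply/mem_set; [exact: (Ag _ HA) | exact: (Ah _ HA)].
Qed.

Lemma generatedV A g : generated A g -> generated A g^-1.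
Proof. by move=> Ag; rewrite -[g^-1]mul1g; exact: generatedD (@generated1 A) Ag. Qed.

Lemma generatedM A g h : generated A g -> generated A h -> generated A (g * h).
Proof. by move=> Ag /generatedV; rewrite -{2}[h]invgK; exact: generatedD. Qed.

Definition spans x y : Prop := forall g, generated [set x; y]%classic g.

Lemma spans_ind x y (P : G -> Prop) : spans x y ->
    P 1 -> (forall g h, P g -> P h -> P (g * h^-1)) -> P x -> P y ->
  forall g, P g.
Proof.
by move=> sxy P1 PD Px Py g; apply: (generated_sub P1 PD) (sxy g) => _ [->|->].
Qed.

Lemma spans_trans x y x' y' : spans x y ->
    generated [set x'; y']%classic x -> generated [set x'; y']%classic y ->
  spans x' y'.
Proof.
move=> sxy gx gy; apply: (spans_ind sxy) => //; first exact: generated1.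
by move=> g h; exact: generatedD.
Qed.

Lemma generated_l x y : generated [set x; y]%classic x.
Proof. by apply: generated_mem; left. Qed.

Lemma generated_r x y : generated [set x; y]%classic y.
Proof. by apply: generated_mem; right. Qed.

Hint Resolve generated_l generated_r : core.

Lemma spansC x y : spans x y -> spans y x.
Proof. by move=> sxy; apply: (spans_trans sxy). Qed.

Lemma spansVl x y : spans x y -> spans x^-1 y.
Proof.
move=> s; apply: (spans_trans s) => //.
by have := generatedV (@generated_l x^-1 y); rewrite invgK.
Qed.

Lemma spansMl x y : spans x y -> spans (x * y) y.
Proof.
move=> s; apply: (spans_trans s) => //.
by have := generatedD (@generated_l (x * y) y) (@generated_r _ _); rewrite mulgK.
Qed.

Lemma spansMr x y : spans x y -> spans (y * x) y.
Proof.
move=> s; apply: (spans_trans s) => //.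
have := generatedM (generatedV (@generated_r (y * x) y)) (@generated_l _ _).
by rewrite mulKg.
Qed.

Lemma spansJ x y g : spans x y -> spans (x ^ g) (y ^ g).
Proof.
move=> s h; rewrite -[h](conjgKV g); move: (h ^ g^-1); apply: (spans_ind s) => //.
- by rewrite conj1g; apply: generated1.
- by move=> u v gu gv; rewrite conjMg conjVg; apply: generatedD.
Qed.

Definition linked : G -> G -> Prop :=
  clos_refl_trans G (adj (generating_graph_star G)).

Lemma star_adjE x y :
  adj (generating_graph_star G) x y <-> x <> y /\ spans x y.
Proof.
have spansE u v : spans u v <-> generated [set u; v]%classic = [set: G]%classic.
  by split=> [s | e g]; [apply/seteqP; split | rewrite e].
split=> [[_ _ [nxy /spansE sxy]] | [nxy sxy]]; first by split.
have axy : gen_adj x y by split=> //; apply/spansE.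
split; last exact: axy.
  by case=> _ /(_ y); apply.
by case=> _ /(_ x); apply; exact: gen_adj_sym.
Qed.

Lemma star_vertexE x :
  vertices (generating_graph_star G) x <-> exists y, x <> y /\ spans x y.
Proof.
split=> [[_ nx]|[y /star_adjE xy]]; last first.
  by have [] := adj_vertices xy.
apply: contrapT => nex; apply: nx; split=> // y xy; apply: nex.
exists y; case: xy => nxy gxy; split=> // g; rewrite gxy //.
Qed.

Lemma linked_trans y x z : linked x y -> linked y z -> linked x z.
Proof. exact: rt_trans. Qed.

Lemma linked_sym x y : linked x y -> linked y x.
Proof.
elim=> [u v uv | u | u v w _ vu _ wv].
- by apply: rt_step; apply: adj_sym.
- exact: rt_refl.
- exact: linked_trans wv vu.
Qed.

Lemma linkedJ x y g : linked x y -> linked (x ^ g) (y ^ g).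
Proof.
elim=> [u v /star_adjE [nuv suv] | u | u v w _ uv _ vw].
- by apply: rt_step; apply/star_adjE; split; [move/conjg_inj | exact: spansJ].
- exact: rt_refl.
- exact: linked_trans uv vw.
Qed.

Hypothesis nonabelian : exists a b : G, a * b <> b * a.

(** Elements that commute and generate make the group abelian.  This is what
    rules out trivial or equal entries in a generating pair. *)
Lemma spans_neq x y : spans x y -> x * y <> y * x.
Proof.
move=> s xy; have [a [b]] := nonabelian; apply.
have cent u : commute u x -> commute u y -> forall g, commute u g.
  move=> ux uy; apply: (spans_ind s) => //; first exact: commute1.
  by move=> g h ug uh; apply: commuteM => //; apply: commuteV.
have xc := cent x (commute_refl x) xy.
have yc := cent y (commute_sym xy) (commute_refl y).
by apply: cent; apply: commute_sym.
Qed.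

Lemma spans_linked x y : spans x y -> linked x y.
Proof.
move=> s; apply: rt_step; apply/star_adjE; split=> // xy.
by apply: (spans_neq s); rewrite xy.
Qed.

Lemma linkedV x y : spans x y -> linked x x^-1.
Proof.
move=> s; apply: (@linked_trans y); first exact: spans_linked.
exact: linked_sym (spans_linked (spansVl s)).
Qed.

(** The elements [g] such that [x] is linked to [x ^ g] form a subgroup, because
    conjugation is an automorphism of the graph.  It contains [x] trivially, and
    [y] through the path from [x] to [y] to [x ^ y]. *)
Lemma linked_conj x y g : spans x y -> linked x (x ^ g).
Proof.
move=> s; move: g; apply: (spans_ind s); first by rewrite conjg1; apply: rt_refl.
- move=> g h xg xh; rewrite conjgM; apply: linked_trans (linkedJ h^-1 xg).
  by apply: linked_sym; move: (linkedJ h^-1 xh); rewrite conjgK.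
- by rewrite conjgE mulKg; apply: rt_refl.
- apply: (linked_trans (spans_linked s)); apply: linked_sym.
  by have /spans_linked := @spansJ _ _ y s; rewrite [y ^ y]conjgE mulKg.
Qed.

End Spanning.

(** * Lyndon length functions *)

Section Lyndon.
Variable G : groupType.
Implicit Types g h q u v w x y : G.

(* Fixing the path from [groupType] to [magmaType] makes equal products
   syntactically equal, which linear arithmetic over their lengths relies on. *)
Local Notation "x * y" := (@mul G x y) : group_scope.

(** [L] is the distance from a base vertex [o] of a tree to its images, and
    [meet g h] the length of the common initial segment of the paths from [o] to
    [g o] and to [h o].  [meet g^-1 h] thus measures the cancellation in
    [g * h].  The last axiom excludes inversions of an edge at [o]. *)
Record lyndon_length (L : G -> nat) (meet : G -> G -> nat) :
  Prop := LyndonLength {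
  len1 : L 1 = 0%N;
  len_eq0 : forall g, L g = 0%N -> g = 1;
  meetE : forall g h, L (g^-1 * h) + (meet g h).*2 = L g + L h;
  meet_ultra : forall h g k, minn (meet g h) (meet h k) <= meet g k;
  len_prefix : forall g k, k <= L g -> exists2 q, L q = k & meet q g = k;
  len1_sqr : forall g, L g = 1%N -> g * g <> 1
}.

Variables (L : G -> nat) (meet : G -> G -> nat).
Hypothesis lyndon : lyndon_length L meet.

Lemma lenV g : L g^-1 = L g.
Proof.
have leV h : L h^-1 <= L h.
  by have := meetE lyndon h 1; rewrite mulg1 (len1 lyndon); lia.
by apply/eqP; rewrite eqn_leq leV /= -{1}[g]invgK leV.
Qed.

Lemma lenM g h : L (g * h) + (meet g^-1 h).*2 = L g + L h.
Proof. by rewrite -(lenV g) -(meetE lyndon) invgK. Qed.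

Lemma len_div g h : L (g^-1 * h) = L (h^-1 * g).
Proof. by rewrite -lenV invgM invgK. Qed.

Lemma meetC g h : meet g h = meet h g.
Proof.
by have := meetE lyndon g h; have := meetE lyndon h g; rewrite len_div; lia.
Qed.

Lemma meet_ler g h : meet g h <= L h.
Proof.
have := meetE lyndon g h; have := lenM h (h^-1 * g).
by rewrite mulVKg (len_div h); lia.
Qed.

(** A geodesic has a single initial segment of each length. *)
Lemma prefix_uniq q q' g : meet q g = L q -> meet q' g = L q' -> L q = L q' ->
  q = q'.
Proof.
move=> qg q'g eqL; have := meet_ultra lyndon g q q'; rewrite (meetC g) qg q'g.
move=> le; have := meetE lyndon q q' => eqM.
have /(len_eq0 lyndon)/mulg1_eq <- : L (q^-1 * q') = 0%N by lia.
by rewrite invgK.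
Qed.

(** In a word [x] equal to [p * s * q^-1], with [p] and [q] of equal length and
    [s] empty or a letter, a cancellation of half of [x] in [x * x] would force
    [p = q].  Then [x] is trivial or a conjugate of the letter [s], and [s] would
    be its own inverse. *)
Lemma meet_sqr x : x <> 1 -> (meet x^-1 x).*2 < L x.
Proof.
move=> nx1; rewrite ltnNge; apply/negP => half.
have [q Lq qx] := @len_prefix _ _ lyndon x (uphalf (L x)) ltac:(lia).
have qV : meet q x^-1 = uphalf (L x).
  have := meet_ultra lyndon x q x^-1; have := meet_ler x^-1 q.
  by rewrite qx (meetC x) (meetC x^-1 q); lia.
have LxV := lenV x.
have eM := lenM x q; have eM' := lenM x^-1 q.
have eN : L q + (meet (x * q) x).*2 = L (x * q) + L x.
  by rewrite -(meetE lyndon) invgM mulgVK lenV.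
have eN' : L q + (meet (x^-1 * q) x^-1).*2 = L (x^-1 * q) + L x^-1.
  by rewrite -(meetE lyndon) invgM mulgVK lenV.
rewrite meetC in eM; rewrite invgK meetC in eM'.
have [even | odd] : uphalf (L x) = (L x)./2 \/ uphalf (L x) = (L x)./2.+1 by lia.
  have xq : x * q = q by apply: (@prefix_uniq _ _ x); lia.
  by apply: nx1; apply: (@mulIg _ q); rewrite mul1g.
have xx : x * x = 1.
  have xVq : x^-1 * q = x * q.
    apply: (@prefix_uniq _ _ x); try lia.
    have := meet_ultra lyndon x^-1 (x^-1 * q) x; have := meet_ler x (x^-1 * q).
    by rewrite (meetC x); lia.
  by rewrite -{1}(mulIg _ _ _ xVq) mulVg.
apply: (len1_sqr lyndon (g := x ^ q)); last by rewrite -conjMg xx conj1g.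
have := meet_ultra lyndon x q (x * q); have := meet_ler q (x * q).
have eJ : L (x ^ q) + (meet q (x * q)).*2 = L q + L (x * q) := meetE lyndon _ _.
by rewrite (meetC x (x * q)); lia.
Qed.

(** * Nielsen reduced sets *)

Definition nielsen_reduced (S : set G) : Prop :=
  [/\ forall u, S u -> 0 < L u,
      forall u v, S u -> S v -> v <> u^-1 -> (meet u^-1 v).*2 <= L v
    & forall t u v, S t -> S u -> S v -> t <> u^-1 -> v <> u^-1 ->
        meet t^-1 u + meet u^-1 v < L u].

Section Reduced.
Variable S : set G.
Hypotheses (symS : forall u, S u -> S u^-1) (redS : nielsen_reduced S).

(** [freely_reduced g u] means that [g] is a freely reduced product of elements
    of [S] with last factor [u].  The last factor is the only part of the
    factorization that controls how the next one cancels. *)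
Inductive freely_reduced : G -> G -> Prop :=
| freely_reduced1 u : S u -> freely_reduced u u
| freely_reducedM g u v : freely_reduced g u -> S v -> v <> u^-1 ->
    freely_reduced (g * v) v.

Lemma freely_reduced_last g u : freely_reduced g u -> S u.
Proof. by case. Qed.

(** The property holds for [h] if and only if it holds for [h * v] with [v] in
    [S], and the elements with this invariance property form a subgroup. *)
Lemma generated_freely_reduced g : generated S g ->
  g = 1 \/ exists u, freely_reduced g u.
Proof.
move=> Sg; pose Q h := h = 1 \/ exists u, freely_reduced h u.
have QM h v : S v -> Q h -> Q (h * v).
  move=> Sv [-> | [u hu]]; first by right; exists v; rewrite mul1g; constructor.
  have [vu | nvu] := pselect (v = u^-1); last first.
    by right; exists v; apply: freely_reducedM hu Sv nvu.
  case: hu vu => [w _ -> | k w u' kw _ _ ->]; first by left; rewrite mulgV.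
  by rewrite mulgK; right; exists w.
suff K : forall h, Q h <-> Q (h * g).
  by move/(K 1): (or_introl _ (erefl 1) : Q 1); rewrite mul1g.
move: g Sg; apply: generated_sub => [h | g1 g2 K1 K2 h | v Sv h].
- by rewrite mulg1.
- by rewrite mulgA; apply: iff_trans (K1 h) _; rewrite (K2 (h * g1 * _)) mulgVK.
- split; first exact: QM.
  by move/(QM _ _ (symS Sv)); rewrite mulgK.
Qed.

(** The part of [u] that the preceding factors cancel and the part that the next
    factor [v] cancels do not meet.  So [g] cancels against [v] exactly as [u]
    does, which gives the induction; and a nonempty part of [u] survives on
    either side, so that the length is at least 2 from the second factor on. *)
Lemma freely_reduced_len g u : freely_reduced g u ->
  [/\ forall v, S v -> v <> u^-1 -> meet g^-1 v = meet u^-1 v,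
      forall v, S v -> v <> u^-1 -> meet u^-1 v < L g
    & g = u \/ 1 < L g].
Proof.
have [S_gt0 S_half S_core] := redS.
have S_half' t v : S t -> S v -> v <> t^-1 -> (meet t^-1 v).*2 <= L t.
  move=> St Sv nvt; rewrite meetC -(lenV t) -{1}[v]invgK.
  by apply: S_half; [exact: symS | exact: symS | rewrite invgK => /esym].
elim=> {g u} [u Su | g u' u gu' [IHmeet IHlen _] Su nu].
  split=> [//| v Sv nv |]; last by left.
  by have := S_half' _ _ Su Sv nv; have := S_gt0 _ Su; lia.
have Su' := freely_reduced_last gu'.
have Lgu := lenM g u; rewrite (IHmeet _ Su nu) in Lgu.
have ltg := IHlen _ Su nu.
have Lg : L g + (meet (g * u)^-1 u^-1).*2 = L (g * u) + L u.
  by rewrite -(lenV (g * u)) -(lenV u) -(meetE lyndon) invgK mulgK.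
have halfu := S_half _ _ Su' Su nu.
have core v : S v -> v <> u^-1 -> meet u'^-1 u + meet u^-1 v < L u.
  by move=> Sv nv; apply: S_core => // u'u; apply: nu; rewrite u'u invgK.
split=> [v Sv nv | v Sv nv |].
- have := core v Sv nv.
  have := meet_ultra lyndon u^-1 (g * u)^-1 v.
  have := meet_ultra lyndon (g * u)^-1 u^-1 v.
  by rewrite (meetC u^-1 (g * u)^-1); lia.
- by have := core v Sv nv; lia.
- by right; have := S_gt0 _ Su; lia.
Qed.

Lemma reduced_len1 g : generated S g -> L g = 1%N -> S g.
Proof.
move=> /generated_freely_reduced [-> | [u gu] Lg]; first by rewrite (len1 lyndon).
have [_ _ [-> | ]] := freely_reduced_len gu; last lia.
exact: freely_reduced_last gu.
Qed.

End Reduced.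

Hypothesis nonabelian : exists a b : G, a * b <> b * a.

(** * Minimal generating pairs *)

Definition minimal_pair u v : Prop := spans u v /\
  forall u' v', spans u' v' -> linked u u' -> L u + L v <= L u' + L v'.

Lemma minimal_pairC u v : minimal_pair u v -> minimal_pair v u.
Proof.
move=> [s min]; split=> [|u' v' s' vu']; first exact: spansC.
by rewrite addnC; apply: min s' _; apply: linked_trans vu'; apply: spans_linked.
Qed.

Lemma minimal_pairVl u v : minimal_pair u v -> minimal_pair u^-1 v.
Proof.
move=> [s min]; split=> [|u' v' s' uu']; first exact: spansVl.
rewrite lenV; apply: min s' _; apply: linked_trans uu'.
exact: linkedV s.
Qed.

Lemma minimal_pairVr u v : minimal_pair u v -> minimal_pair u v^-1.
Proof. by move=> /minimal_pairC/minimal_pairVl/minimal_pairC. Qed.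

Lemma minimal_pair_gt0 u v : minimal_pair u v -> 0 < L u.
Proof.
move=> [s _]; rewrite lt0n; apply/eqP => /(len_eq0 lyndon) u1.
by apply: (spans_neq nonabelian s); rewrite u1 mulg1 mul1g.
Qed.

Lemma minimal_pair_meet u v : minimal_pair u v -> (meet u^-1 v).*2 <= L u.
Proof.
move=> [s min]; have s' : spans u (u * v) := spansC (spansMr (spansC s)).
by have := min _ _ s' (rt_refl _ _ _); have := lenM u v; lia.
Qed.

(** If the cancellations in [v * u * v] consumed [u], then, for [q] the prefix of
    length [L u / 2] of [v], the elements [u ^ q] and [(v * u) ^ q] would have
    lengths at most [L u] and [L v - L u]. *)
Lemma minimal_pair_core u v : minimal_pair u v ->
  meet v^-1 u + meet u^-1 v < L u.
Proof.
move=> m; have [s min] := m; rewrite ltnNge; apply/negP => full.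
have u_gt0 := minimal_pair_gt0 m.
have half1 := minimal_pair_meet m.
have half2 := minimal_pair_meet (minimal_pairVl (minimal_pairVr m)).
have half3 := minimal_pair_meet (minimal_pairC m).
rewrite invgK lenV meetC in half2.
set k := meet u^-1 v in full half1.
have [q Lq qv] := @len_prefix _ _ lyndon v k (meet_ler _ _).
(* [q] is the inverse of the second half of [u]: [u * q] is the first half. *)
have uVq : meet u^-1 q = k.
  have := meet_ultra lyndon v q u^-1; have := meet_ler u^-1 q.
  by rewrite (meetC v) (meetC q u^-1) -/k; lia.
have Luq := lenM u q.
have uuq : L q + (meet (u * q) u).*2 = L (u * q) + L u.
  by rewrite -(meetE lyndon) invgM mulgVK lenV.
have Lvuq := lenM v (u * q).
have vuq : meet v^-1 (u * q) = k.
  have := meet_ultra lyndon u v^-1 (u * q); have := meet_ler v^-1 (u * q).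
  by rewrite (meetC u); lia.
have vvuq : L (u * q) + (meet (v * (u * q)) v).*2 = L (v * (u * q)) + L v.
  by rewrite -(meetE lyndon) invgM mulgVK lenV.
have qvuq := meet_ultra lyndon v q (v * (u * q)).
rewrite (meetC v) in qvuq.
have Luj : L (u ^ q) + (meet q (u * q)).*2 = L q + L (u * q) := meetE lyndon _ _.
have Lvuj : L ((v * u) ^ q) + (meet q (v * (u * q))).*2 = L q + L (v * (u * q)).
  by rewrite -(meetE lyndon) mulgA.
have sJ : spans (u ^ q) ((v * u) ^ q).
  exact: spansJ (spansC (spansMl (spansC s))).
by have := min _ _ sJ (linked_conj nonabelian q s); lia.
Qed.

Definition signed_pair u v : set G :=
  [set w | [\/ w = u, w = u^-1, w = v | w = v^-1]]%classic.

Lemma signed_pairV u v w : signed_pair u v w -> signed_pair u v w^-1.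
Proof.
case=> ->; rewrite ?invgK;
  [exact: Or42 | exact: Or41 | exact: Or44 | exact: Or43].
Qed.

Lemma minimal_signed_pair x y u : minimal_pair x y -> signed_pair x y u ->
  exists2 v, minimal_pair u v & forall w, signed_pair x y w -> signed_pair u v w.
Proof.
move=> m xyu.
have sub v : signed_pair u v x -> signed_pair u v y ->
    forall w, signed_pair x y w -> signed_pair u v w.
  by move=> ux uy w [] -> //; apply: signed_pairV.
have mC := minimal_pairC m; case: xyu sub => -> sub.
- by exists y.
- exists y; first exact: minimal_pairVl.
  by apply: sub; [rewrite -{2}[x]invgK; exact: Or42 | exact: Or43].
- by exists x => //; apply: sub; [exact: Or43 | exact: Or41].
- exists x; first exact: minimal_pairVl.
  by apply: sub; [exact: Or43 | rewrite -{2}[y]invgK; exact: Or42].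
Qed.

(** A letter cancels less than half of itself against a copy of itself, and at
    most half against the others.  The bound on both sides at once can then only
    fail when two halves cancel, against letters from the other generator: the
    same letter on both sides is [minimal_pair_core], and opposite letters are
    excluded by uniqueness of prefixes. *)
Lemma minimal_pair_reduced x y : minimal_pair x y ->
  nielsen_reduced (signed_pair x y).
Proof.
move=> m.
have half u v : minimal_pair u v ->
    [/\ (meet u^-1 v).*2 <= L u, (meet u^-1 v).*2 <= L v & (meet u^-1 u).*2 < L u].
  move=> uv; split; first exact: minimal_pair_meet.
    rewrite meetC -(lenV v) -{1}[v]invgK.
    exact/minimal_pair_meet/minimal_pairVl/minimal_pairVr/minimal_pairC.
  by apply: meet_sqr => u1; have := minimal_pair_gt0 uv; rewrite u1 (len1 lyndon).
split=> [u /(minimal_signed_pair m) [v uv _] | u w | t u w].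
- exact: minimal_pair_gt0 uv.
- move=> /(minimal_signed_pair m) [v uv sub] /sub [] -> // _.
  + by have [_ _ /ltnW] := half _ _ uv.
  + by have [] := half _ _ uv.
  + by have [] := half _ _ (minimal_pairVr uv).
move=> xyt /(minimal_signed_pair m) [v uv sub] /sub uw nt nw.
have uVv := minimal_pairVr uv.
have [hv _ hu] := half _ _ uv; have [hVv _ _] := half _ _ uVv.
have [hvV _ _] := half _ _ (minimal_pairVl uv); rewrite invgK lenV meetC in hvV.
have [hVvV _ _] := half _ _ (minimal_pairVl uVv); rewrite invgK lenV meetC in hVvV.
have cv := minimal_pair_core uv; have cVv := minimal_pair_core uVv.
rewrite invgK in cVv.
(* The prefixes of length half that [u] and [u^-1] share with the same element
   would coincide, so they cannot both be that long. *)
have uv_uV := meet_ultra lyndon v u^-1 u.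
have uVv_uV := meet_ultra lyndon v^-1 u^-1 u.
have /sub := xyt; case=> tE; rewrite {}tE ?invgK in nt *;
  case: uw nw => -> nw; solve [by case: nt | by case: nw | lia].
Qed.

Lemma spans_linked_len1 x y c : spans x y -> L c = 1%N -> linked x c.
Proof.
move=> s c1.
pose P n := `[< exists u v, [/\ spans u v, linked x u & L u + L v = n] >].
have exP : exists n, P n.
  by exists (L x + L y)%N; apply/asboolP; exists x, y; split=> //; apply: rt_refl.
case: (ex_minnP exP) => n /asboolP [u [v [suv xu Ln]]] minn.
have m : minimal_pair u v.
  split=> // u' v' s' uu'; rewrite Ln; apply: minn; apply/asboolP.
  by exists u', v'; split=> //; apply: linked_trans uu'.
have uv := spans_linked nonabelian suv.
have uc : signed_pair u v c.
  apply: reduced_len1 c1; [exact: signed_pairV | exact: minimal_pair_reduced |].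
  apply: (spans_ind suv) => [| g h Sg Sh ||].
  - exact: generated1.
  - exact: generatedD.
  - by apply: generated_mem; exact: Or41.
  - by apply: generated_mem; exact: Or43.
apply: (linked_trans xu).
case: uc => ->; [exact: rt_refl | exact: linkedV suv | exact: uv |].
exact: linked_trans uv (linkedV nonabelian (spansC suv)).
Qed.

End Lyndon.

(** * Reduced words *)

Section Words.
Variable n : nat.

Definition letter : Type := ('I_n * bool)%type.
Implicit Types (s t : letter) (u v w : seq letter).

Definition opp s : letter := (s.1, ~~ s.2).

Lemma oppK s : opp (opp s) = s.
Proof. by case: s => i e; rewrite /opp /= negbK. Qed.

Lemma opp_neq s : (s == opp s) = false.
Proof. by case: s => i e; rewrite xpair_eqE eqxx; case: e. Qed.

Definition reduced u : bool := sorted (fun s t => t != opp s) u.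

Definition lmul s u : seq letter :=
  if u is t :: u' then if t == opp s then u' else s :: u else [:: s].

Lemma lmul_reduced s u : reduced u -> reduced (lmul s u).
Proof.
case: u => //= t u ru; case: eqP => [_ | /eqP nts]; first exact: path_sorted ru.
by rewrite /= nts.
Qed.

Lemma lmul_cons s u : reduced (s :: u) -> lmul s u = s :: u.
Proof. by case: u => //= t u /andP [/negPf ->]. Qed.

Lemma lmulK s u : reduced u -> lmul (opp s) (lmul s u) = u.
Proof.
case: u => [_ | t u ru] /=; first by rewrite oppK eqxx.
case: eqP ru => [-> /lmul_cons -> // | _ _].
by rewrite /= oppK eqxx.
Qed.

Fixpoint lcp u v : nat :=
  match u, v with
  | s :: u', t :: v' => if s == t then (lcp u' v').+1 else 0
  | _, _ => 0
  end.

Arguments lcp : simpl never.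

Lemma lcp0l u : lcp [::] u = 0. Proof. by []. Qed.

Lemma lcp0r u : lcp u [::] = 0. Proof. by case: u. Qed.

Lemma lcp_cons s t u v :
  lcp (s :: u) (t :: v) = if s == t then (lcp u v).+1 else 0.
Proof. by []. Qed.

Lemma lcpC u v : lcp u v = lcp v u.
Proof.
by elim: u v => [|s u IH] [|t v] //; rewrite !lcp_cons eq_sym IH.
Qed.

Lemma lcp_ultra v u w : minn (lcp u v) (lcp v w) <= lcp u w.
Proof.
elim: v u w => [|s v IH] [|t u] [|r w]; rewrite ?lcp0l ?lcp0r ?minn0 ?min0n //.
rewrite !lcp_cons; case: (t =P s) => [-> | _]; last by rewrite min0n.
by case: (s =P r) => [_ | _]; [rewrite minnSS; exact: IH | rewrite minn0].
Qed.

Lemma lcp_take k u : k <= size u -> lcp (take k u) u = k.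
Proof.
by elim: u k => [|s u IH] [|k] //= ku; rewrite lcp_cons eqxx IH.
Qed.

(** Left multiplication by a letter is an isometry of the tree of reduced words,
    where the distance from [u] to [v] is
    [size u + size v - (lcp u v).*2]. *)
Lemma lcp_lmul s u v : reduced u -> reduced v ->
  size (lmul s u) + size (lmul s v) + (lcp u v).*2
    = size u + size v + (lcp (lmul s u) (lmul s v)).*2.
Proof.
have cancel t w x : reduced (t :: w) -> t = opp s -> lcp w (s :: x) = 0.
  case: w => //= r w /andP [nr _] ts; rewrite ts oppK in nr.
  by rewrite lcp_cons (negPf nr).
case: u v => [|t u] [|r v] ru rv /=; rewrite ?lcp_cons ?lcp0l ?lcp0r ?eqxx //.
- case: eqP => [rs | _] /=; last by rewrite lcp_cons eqxx lcp0l; lia.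
  by rewrite lcpC (cancel _ _ _ rv rs); lia.
- case: eqP => [ts | _] /=; last by rewrite lcp_cons eqxx lcp0r; lia.
  by rewrite (cancel _ _ _ ru ts); lia.
case: (t =P opp s) => [ts | nt]; case: (r =P opp s) => [rs | nr] /=.
- by rewrite ts rs eqxx; lia.
- rewrite (cancel _ _ _ ru ts) ts; case: eqP => [rs | _]; last lia.
  by case: nr.
- rewrite (lcpC (_ :: _)) (cancel _ _ _ rv rs); case: eqP => [tr | _]; last lia.
  by case: nt; rewrite tr.
- by rewrite !lcp_cons eqxx; lia.
Qed.

Definition rword : Type := {u : seq letter | reduced u}.

Definition rnil : rword := exist _ [::] isT.

Definition rlmul s (w : rword) : rword :=
  exist _ (lmul s (val w)) (lmul_reduced s (valP w)).

Lemma rlmulK s : cancel (rlmul s) (rlmul (opp s)).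
Proof. by move=> w; apply: val_inj; apply: lmulK; apply: valP. Qed.

End Words.

(** * Normal forms in a free group *)

Section WordAction.
Variables (F : groupType) (n : nat) (b : 'I_n -> F).

Definition gen (s : letter n) : F := if s.2 then b s.1 else (b s.1)^-1.

Definition eval (u : seq (letter n)) : F := foldr (fun s g => gen s * g) 1 u.

Lemma gen_opp s : gen (opp s) = (gen s)^-1.
Proof. by case: s => i []; rewrite /gen //= invgK. Qed.

Lemma eval_lmul s u : eval (lmul s u) = gen s * eval u.
Proof.
case: u => [|t u] //=; case: eqP => //= ->.
by rewrite gen_opp mulVKg.
Qed.

(** Permutations of the reduced words paired with an element of [F] that acts
    compatibly on the values of words.  Carrying this element along makes the
    morphism from [F] given by the universal property commute with evaluation;
    otherwise one would first have to show that the basis generates [F]. *)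
Record word_action : Type := WordAction {
  act : rword n -> rword n;
  act_inv : rword n -> rword n;
  elt : F;
  actK : cancel act act_inv;
  act_invK : cancel act_inv act;
  eval_act : forall w, eval (val (act w)) = elt * eval (val w)
}.

Lemma word_action_eq (f g : word_action) :
  act f = act g -> act_inv f = act_inv g -> elt f = elt g -> f = g.
Proof.
case: f g => [a a' x aK a'K ax] [c c' y cK c'K cy] /= ac ac' xy.
subst c c' y.
rewrite (Prop_irrelevance aK cK) (Prop_irrelevance a'K c'K).
by rewrite (Prop_irrelevance ax cy).
Qed.

HB.instance Definition _ := gen_eqMixin word_action.
HB.instance Definition _ := gen_choiceMixin word_action.

Definition word_action_one : word_action.
Proof. by apply: (@WordAction id id 1) => // w; rewrite mul1g. Defined.

Definition word_action_mul (f g : word_action) : word_action.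
Proof.
apply: (@WordAction (act f \o act g) (act_inv g \o act_inv f) (elt f * elt g)).
- by move=> w /=; rewrite !actK.
- by move=> w /=; rewrite !act_invK.
- by move=> w /=; rewrite !eval_act mulgA.
Defined.

Definition word_action_inv (f : word_action) : word_action.
Proof.
apply: (@WordAction (act_inv f) (act f) (elt f)^-1).
- exact: act_invK.
- exact: actK.
- by move=> w; apply: (mulgI (elt f)); rewrite mulVKg -eval_act act_invK.
Defined.

Lemma word_action_mulA : associative word_action_mul.
Proof. by move=> f g h; apply: word_action_eq => //=; rewrite mulgA. Qed.

Lemma word_action_mul1 : left_id word_action_one word_action_mul.
Proof. by move=> f; apply: word_action_eq => //=; rewrite mul1g. Qed.

Lemma word_action_mulr1 : right_id word_action_one word_action_mul.
Proof. by move=> f; apply: word_action_eq => //=; rewrite mulg1. Qed.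

Lemma word_action_mulV :
  left_inverse word_action_one word_action_inv word_action_mul.
Proof.
move=> f; apply: word_action_eq => /=; last exact: mulVg.
- by apply/funext => w /=; rewrite actK.
- by apply/funext => w /=; rewrite actK.
Qed.

Lemma word_action_mulrV :
  right_inverse word_action_one word_action_inv word_action_mul.
Proof.
move=> f; apply: word_action_eq => /=; last exact: mulgV.
- by apply/funext => w /=; rewrite act_invK.
- by apply/funext => w /=; rewrite act_invK.
Qed.

HB.instance Definition _ := isGroup.Build word_action
  word_action_mulA word_action_mul1 word_action_mulr1
  word_action_mulV word_action_mulrV.

Lemma elt_is_multiplicative : {morph elt : f g / f * g}.
Proof. by []. Qed.

HB.instance Definition _ :=
  isMultiplicative.Build word_action F elt elt_is_multiplicative.

Definition letter_action (s : letter n) : word_action.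
Proof.
apply: (@WordAction (rlmul s) (rlmul (opp s)) (gen s)).
- exact: rlmulK.
- by move=> w; rewrite -{1}[s]oppK rlmulK.
- by move=> w; apply: eval_lmul.
Defined.

Lemma letter_actionV i : letter_action (i, false) = (letter_action (i, true))^-1.
Proof. exact: word_action_eq. Qed.

Definition normal_form (word : F -> seq (letter n)) : Prop :=
  [/\ forall g, reduced (word g), forall g, eval (word g) = g, word 1 = [::]
    & forall s g, word (gen s * g) = lmul s (word g)].

(** The normal form of [g] is the image of the empty word under the action of
    [g].  Its value is [g] because the projection [elt], composed with the
    action, fixes the basis, hence is the identity of [F]. *)
Lemma free_normal_form : free_basis b -> exists word, normal_form word.
Proof.
move=> free; have [f [fb _]] := free _ (fun i => letter_action (i, true)).
have eltf g : elt (f g) = g.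
  have [id' [_ uniq]] := free _ b.
  rewrite -[RHS]/(idfun g) (uniq idfun) // -(uniq (elt \o f)) //.
  by move=> i /=; rewrite fb.
have f1 : f 1 = 1 by apply: (mulgI (f 1)); rewrite -gmulfM !mulg1.
have fV g : f g^-1 = (f g)^-1.
  by apply: (mulgI (f g)); rewrite -gmulfM !mulgV.
have fgen s : f (gen s) = letter_action s.
  case: s => i []; first exact: fb.
  by rewrite letter_actionV -fb; apply: fV.
exists (fun g => val (act (f g) (rnil n))); split.
- by move=> g; apply: valP.
- by move=> g; rewrite eval_act eltf mulg1.
- by rewrite f1.
- by move=> s g; rewrite gmulfM fgen.
Qed.

Section NormalForm.
Variable word : F -> seq (letter n).
Hypothesis nf : normal_form word.

Lemma word_evalK u : reduced u -> word (eval u) = u.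
Proof.
have [_ _ word1 wordM] := nf; elim: u => [|s u IH] ru //=.
by rewrite wordM IH ?lmul_cons //; apply: path_sorted ru.
Qed.

(** Left translations are products of the isometries of [lcp_lmul]. *)
Lemma word_lcp x g h :
  size (word (x * g)) + size (word (x * h)) + (lcp (word g) (word h)).*2
    = size (word g) + size (word h) + (lcp (word (x * g)) (word (x * h))).*2.
Proof.
have [word_red evalK _ wordM] := nf.
rewrite -(evalK x); elim: (word x) => [|s u IH] /=; first by rewrite !mul1g.
have word_step y : word (gen s * eval u * y) = lmul s (word (eval u * y)).
  by rewrite -mulgA wordM.
rewrite !word_step.
by have := lcp_lmul s (word_red (eval u * g)) (word_red (eval u * h)); lia.
Qed.

Lemma normal_form_lyndon :
  lyndon_length (size \o word) (fun g h => lcp (word g) (word h)).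
Proof.
have [word_red evalK word1 wordM] := nf.
split=> [|g /size0nil wg|g h|h g k|g k kg|g /= Lg gg] /=.
- by rewrite word1.
- by rewrite -(evalK g) wg.
- by have := word_lcp g^-1 g h; rewrite mulVg word1 lcp0l /=; lia.
- exact: lcp_ultra.
- have rk : reduced (take k (word g)) := take_sorted k (word_red g).
  exists (eval (take k (word g))); rewrite word_evalK ?lcp_take //.
  exact: size_takel.
- have [s ws] : exists s, word g = [:: s].
    by case: (word g) Lg => [|s []] // _; exists s.
  have gs : g = gen s by rewrite -(evalK g) ws /= mulg1.
  have := wordM s g; rewrite -gs gg word1 ws /=.
  by rewrite opp_neq.
Qed.

Lemma word_basis i : word (b i) = [:: (i, true)].
Proof. by rewrite -[b i]mulg1 -[RHS](@word_evalK _ _). Qed.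

Lemma basis_noncommuting i j : i != j -> b i * b j <> b j * b i.
Proof.
move=> ij /(congr1 word); have [_ _ _ wordM] := nf.
rewrite (wordM (i, true)) (wordM (j, true)) !word_basis /= !xpair_eqE !andbF.
by case=> eij; rewrite eij eqxx in ij.
Qed.

Lemma basis_generates (A : set F) :
  (forall i, A (b i)) -> forall g, generated A g.
Proof.
move=> Ab g; have [_ evalK _ _] := nf; rewrite -(evalK g).
elim: (word g) => [|s u IH] /=; first exact: generated1.
apply: generatedM => //; have gb := generated_mem (Ab s.1).
by rewrite /gen; case: s.2 => //; apply: generatedV.
Qed.

End NormalForm.
End WordAction.

(** * Connectedness *)

Theorem theorem11 (F : groupType) (hF : is_free_group F 2) :
  connected_graph (generating_graph_star F).
Proof.
have [b /free_normal_form [word nf]] := hF.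
have lyndon := normal_form_lyndon nf.
pose x0 := b ord0; pose y0 := b ord_max.
have nab : exists x y : F, x * y <> y * x.
  by exists x0, y0; apply: (basis_noncommuting nf).
have s0 : spans x0 y0.
  apply: (basis_generates nf) => i.
  have := ltn_ord i.
  by case: (ltnP i 1) => hi; [left | right]; congr b; apply: val_inj => /=; lia.
have to_x0 x : vertices (generating_graph_star F) x -> linked x x0.
  move=> /star_vertexE [y [_ sxy]].
  by apply: (spans_linked_len1 lyndon nab sxy); rewrite /= (word_basis nf).
split.
  exists x0; apply/star_vertexE; exists y0; split=> // xy.
  by apply: (spans_neq nab s0); rewrite xy.
move=> x y vx vy; apply: linked_trans (to_x0 x vx) _.
exact: linked_sym (to_x0 y vy).
Qed.
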